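(* Let $\ell\in\mathbb N^*$. Let $\mathbf p$ be an offspring distribution with mean $\mu<1$, with $\mathbf p(0)+\mathbf p(1)<1$, and admitting a moment of order $\ell$, and let $\mathbf q$ be a mark function such that $\mathbf p(k)\mathbf q(k)>0$ for some $k\in\mathbb N$. Let $\mathbb P$ be the distribution of the marked Galton-Watson tree with offspring distribution $\mathbf p$ and mark function $\mathbf q$, and let $\mathbb Q_\ell$ be the probability measure on $(\mathbb T^*,\mathscr F)$ defined by $$\forall n\in\mathbb N,\qquad \frac{d\mathbb Q_\ell}{d\mathbb P}\Big|_{\mathscr F_n}=f_\ell(M_n,Z_n).$$ Then $\mathbb Q_\ell$ is the distribution of the weighted tree of type $\ell$, i.e. of the random marked tree $\tau_\ell(\mathbf p,\mathbf q)$ defined in the context.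
   Context: $\mathbb N=\{0,1,2,\dots\}$, $\mathbb N^*=\{1,2,\dots\}$. Let $\mathscr U=\bigcup_{n\ge0}(\mathbb N^* )^n$ be the set of finite sequences of positive integers, $|u|$ the length of $u$, $\emptyset$ the empty sequence. A tree $\mathbf t$ is a subset of $\mathscr U$ such that $\emptyset\in\mathbf t$; $uj\in\mathbf t\Rightarrow u\in\mathbf t$ (for $j\in\mathbb N^*$); and for each $u\in\mathbf t$ there is $k_u(\mathbf t)\in\mathbb N$ with $ui\in\mathbf t\iff i\le k_u(\mathbf t)$. A marked tree is $\mathbf t^*=(\mathbf t,(\eta_u)_{u\in\mathbf t})$ with $\eta_u\in\{0,1\}$; $\mathbb T^*$ is the set of marked trees. For $n\in\mathbb N$, $r_n^*(\mathbf t^* )$ is the marked tree consisting of the nodes $u\in\mathbf t$ with $|u|\le n$, keeping the marks of nodes with $|u|\le n-1$ and setting the marks at level $n$ to $0$. $\mathscr F_n$ is the $\sigma$-field on $\mathbb T^*$ generated by $r_n^*$, and $\mathscr F=\bigvee_n\mathscr F_n$. $z_n(\mathbf t^* )=\{u\in\mathbf t:|u|=n\}$, $Z_n=\mathrm{Card}(z_n)$; $M_0=0$ and $M_n(\mathbf t^* )=\sum_{u\in\mathbf t,|u|\le n-1}\eta_u$ for $n\ge1$. An offspring distribution is a probability distribution $\mathbf p$ on $\mathbb N$; a mark function is a map $\mathbf q:\mathbb N\to[0,1]$. Set $\mathbf p_0(k,1)=\mathbf p(k)\mathbf q(k)$, $\mathbf p_0(k,0)=\mathbf p(k)(1-\mathbf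 q(k))$. The marked Galton-Watson tree distribution $\mathbb P$ is the unique probability measure on $(\mathbb T^*,\mathscr F)$ such that, with $\tau^*$ the identity map of $\mathbb T^*$, for all $h\ge1$ and $\mathbf t^*\in\mathbb T^*$, $\mathbb P(r_h^*(\tau^* )=r_h^*(\mathbf t^* ))=\prod_{u\in\mathbf t,|u|\le h-1}\mathbf p_0(k_u(\mathbf t),\eta_u)$; $\mathbb E$ is the expectation under $\mathbb P$. For $0\le i\le\ell$ put $\xi_i=\lim_{p\to\infty}\mathbb E[M_p^i]$ (finite and positive under the hypotheses) and, for $z\in\mathbb N$ and real $s\ge0$, $$f_i(s,z)=\frac1{\xi_i}\sum_{a=0}^{i}\binom{i}{a}s^{i-a}\sum_{t_1+\cdots+t_z=a}\binom{a}{t_1\cdots t_z}\prod_{j=1}^z\xi_{t_j},$$ with $t_j\in\mathbb N$, $0^0=1$, $f_i(s,0)=s^i/\xi_i$ (so $f_0\equiv1$). Masses. For a marked tree $\mathbf t^*$, the mass $m_u$ of each node $u\in\mathbf t$ is defined recursively by $m_\emptyset=0$ and, for $u\in z_n(\mathbf t^* )$ and $1\le j\le k_u(\mathbf t)$, $$m_{uj}=\frac{m_u+\eta_u}{k_u(\mathbf t)}+\frac{\sum_{w\in z_n(\mathbf t^* ),\,k_w(\mathbf t)=0}(m_w+\eta_w)}{Z_{n+1}(\mathbf t^* )}.$$ The masses of the nodes at generation $n$ depend only on $r_n^*(\mathbf t^* )$. Weighted tree of type $\ell$. $\tau_\ell(\mathbf p,\mathbf q)$ is a random marked tree whose nodes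 carry types in $\{0,\dots,\ell\}$, defined on some probability space recursively as follows. The root has type $\ell$. Suppose $r_n^*(\tau_\ell)$ and the types of the nodes at generation $n$ are given. Then the nodes of generation $n$ choose their number of children and their mark independently of each other: a node of type $0$ has $k$ children and mark $\eta$ with probability $\mathbf p_0(k,\eta)$; a node $u$ of type $i\in\{1,\dots,\ell\}$ with mass $m_u$ has $k$ children and mark $\eta$ with probability $\mathbf p_0(k,\eta)f_i(m_u+\eta,k)/f_i(m_u,1)$. This determines $r_{n+1}^*(\tau_\ell)$. If generation $n+1$ is nonempty, then, conditionally given $r_{n+1}^*(\tau_\ell)$ (and independently of the previous types), the nodes of $z_{n+1}$ receive types $(t_u)_{u\in z_{n+1}}\in\mathbb N^{z_{n+1}}$ with $\sum_{u\in z_{n+1}}t_u=\ell$ with probability $$\frac{\ell!}{\prod_{u\in z_{n+1}}t_u!}\cdot\frac{\prod_{u\in z_{n+1}}f_{t_u}(m_u,1)\,\xi_{t_u}}{\xi_\ell\, f_\ell(M_{n+1},Z_{n+1})}.$$ *)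

(* Defs.v *)
From HB Require Import structures.
From mathcomp Require Import all_boot all_order all_algebra finmap.
From mathcomp Require Import all_classical all_reals all_analysis.

Set Implicit Arguments.
Unset Strict Implicit.
Unset Printing Implicit Defensive.
Import Order.TTheory GRing.Theory Num.Theory.
Import numFieldNormedType.Exports.

Local Open Scope classical_set_scope.
Local Open Scope ring_scope.

(* Marks are functions on all of [seq nat]; they are required to vanish off the
   tree, so that two marked trees are equal iff they have the same nodes and the
   same marks on these nodes. *)
Record marked_tree := MarkedTree {
  node : set (seq nat) ;
  mark : seq nat -> bool ;
  node_label : forall u, node u -> all (leq 1) u ;
  node_root : node [::] ;
  node_parent : forall u j, node (rcons u j) -> node u ;
  node_children : forall u, node u ->
    exists k, forall j, (0 < j)%N -> (node (rcons u j) <-> (j <= k)%N) ;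
  mark_node : forall u, mark u -> node u }.

Lemma marked_tree_eq (t t' : marked_tree) :
  node t = node t' -> mark t = mark t' -> t = t'.
Proof.
case: t => N e a b c d f; case: t' => N' e' a' b' c' d' f' /= eN ee.
by subst N' e'; congr MarkedTree; exact: Prop_irrelevance.
Qed.

Section truncation.
Variables (n : nat) (t : marked_tree).

Definition trunc_node : set (seq nat) := [set u | node t u /\ (size u <= n)%N].

Definition trunc_mark (u : seq nat) : bool := mark t u && (size u < n)%N.

Lemma trunc_label u : trunc_node u -> all (leq 1) u.
Proof. by case=> /node_label. Qed.

Lemma trunc_root : trunc_node [::].
Proof. by split=> //; exact: node_root. Qed.

Lemma trunc_parent u j : trunc_node (rcons u j) -> trunc_node u.
Proof. by case=> /node_parent tu; rewrite size_rcons => /ltnW. Qed.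

Lemma trunc_children u : trunc_node u ->
  exists k, forall j, (0 < j)%N -> (trunc_node (rcons u j) <-> (j <= k)%N).
Proof.
case=> /node_children[k tk] un; case: (ltnP (size u) n) => un'.
  exists k => j j0; split=> [[/tk->//]|jk].
  by split; [exact/tk|rewrite size_rcons].
exists 0%N => j j0; split=> [[_]|]; last by rewrite leqNgt j0.
by rewrite size_rcons ltnNge un'.
Qed.

Lemma trunc_mark_node u : trunc_mark u -> trunc_node u.
Proof. by case/andP=> /mark_node tu /ltnW. Qed.

Definition trunc : marked_tree :=
  MarkedTree trunc_label trunc_root trunc_parent trunc_children trunc_mark_node.

End truncation.

Lemma trivial_label u : [set [::] : seq nat] u -> all (leq 1) u.
Proof. by move=> ->. Qed.

Lemma trivial_parent u j :
  [set [::] : seq nat] (rcons u j) -> [set [::] : seq nat] u.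
Proof. by case: u. Qed.

Lemma trivial_children u : [set [::] : seq nat] u ->
  exists k, forall j, (0 < j)%N ->
    ([set [::] : seq nat] (rcons u j) <-> (j <= k)%N).
Proof. by move=> ->; exists 0%N => j j0; split=> //; rewrite leqNgt j0. Qed.

Lemma trivial_mark u : false -> [set [::] : seq nat] u.
Proof. by []. Qed.

Definition trivial_tree : marked_tree :=
  MarkedTree trivial_label erefl trivial_parent trivial_children trivial_mark.

HB.instance Definition _ := gen_eqMixin marked_tree.
HB.instance Definition _ := gen_choiceMixin marked_tree.
HB.instance Definition _ := isPointed.Build marked_tree trivial_tree.

(* The map [trunc n] has countable range: the sigma-field that it generates
   consists of the preimages of arbitrary sets of marked trees. *)
Definition filtration (n : nat) : set_system marked_tree :=
  preimage_set_system setT (trunc n) setT.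

Notation mtree := (g_sigma_algebraType (\bigcup_n filtration n)).

Definition gen (t : marked_tree) (n : nat) : set (seq nat) :=
  [set u | node t u /\ size u = n].

Definition gen_lt (t : marked_tree) (n : nat) : set (seq nat) :=
  [set u | node t u /\ (size u < n)%N].

Definition nchild (t : marked_tree) (u : seq nat) : nat :=
  xget 0%N [set k | forall j, (0 < j)%N -> (node t (rcons u j) <-> (j <= k)%N)].

Lemma nchildP t u j : node t u -> (0 < j)%N ->
  node t (rcons u j) <-> (j <= nchild t u)%N.
Proof. by move=> /node_children/(xgetPex 0%N); exact. Qed.

Lemma finite_gen t n : finite_set (gen t n).
Proof.
elim: n => [|n IHn].
  by apply: (@sub_finite_set _ _ [set [::]]) => // u [_ /size0nil].
have : finite_set (\bigcup_(u in gen t n) (rcons u @` `I_(nchild t u).+1)).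
  by apply: bigcup_finite => // u _; exact/finite_image/finite_II.
apply: sub_finite_set => v []; case/lastP: v => // u j tuj.
rewrite size_rcons => -[un]; have tu := node_parent tuj.
exists u => //; exists j => //=; rewrite ltnS; apply/nchildP => //.
by have /= := node_label tuj; rewrite all_rcons => /andP[].
Qed.

Definition Z (n : nat) (t : marked_tree) : nat := #|` fset_set (gen t n)|.

Definition M (n : nat) (t : marked_tree) : nat :=
  (\big[addn/0]_(u \in gen_lt t n) (mark t u : nat))%N.

Section mass.
Variables (R : realType) (t : marked_tree).

(* The values of [mass_at n] are meaningful on generation [n] only; the parent
   of a node [v] of generation [n.+1] is [take n v]. *)
Fixpoint mass_at (n : nat) (v : seq nat) : R :=
  if n is n'.+1 then
    let u := take n' v in
    (mass_at n' u + (mark t u)%:R) / (nchild t u)%:R +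
    (\sum_(w \in gen t n' `&` [set w | nchild t w = 0%N])
       (mass_at n' w + (mark t w)%:R)) / (Z n'.+1 t)%:R
  else 0.

Definition mass (u : seq nat) : R := mass_at (size u) u.

Lemma mass_root : mass [::] = 0. Proof. by []. Qed.

Lemma mass_child n u j : gen t n u -> (0 < j <= nchild t u)%N ->
  mass (rcons u j) = (mass u + (mark t u)%:R) / (nchild t u)%:R +
    (\sum_(w \in gen t n `&` [set w | nchild t w = 0%N])
       (mass w + (mark t w)%:R)) / (Z n.+1 t)%:R.
Proof.
move=> [tu <-] _; rewrite /mass size_rcons /= -cats1 take_size_cat//.
congr (_ + _ / _); apply: eq_fsbigr => w; rewrite inE => -[[_ wu] _].
by rewrite wu.
Qed.

End mass.

Definition is_offspring (R : realType) (p : nat -> R) :=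
  (forall k, 0 <= p k) /\ (\sum_(0 <= k <oo) (p k)%:E = 1)%E.

Definition p0 (R : realType) (p q : nat -> R) (k : nat) (eta : bool) : R :=
  if eta then p k * q k else p k * (1 - q k).

Definition is_marked_GW (R : realType) (p q : nat -> R)
    (P : probability mtree R) :=
  forall h t, (1 <= h)%N ->
    P [set t' | trunc h t' = trunc h t] =
    (\big[*%R/1]_(u \in gen_lt t h) p0 p q (nchild t u) (mark t u))%:E.

Section weights.
Variables (R : realType) (P : probability mtree R).

(* The limit is taken in the extended reals, where it exists by monotonicity;
   [fine] is harmless when it is finite, as for [i <= l] in the theorem. *)
Definition xi (i : nat) : R :=
  fine (limn (fun n => 'E_P[(fun t : mtree => ((M n t)%:R ^+ i)%R)]%E)).

(* For [z = 0] there is exactly one empty family, with sum 0, so that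
   [fweight i s 0 = s ^+ i / xi i]. *)
Definition fweight (i : nat) (s : R) (z : nat) : R :=
  (xi i)^-1 *
  \sum_(a < i.+1) 'C(i, a)%:R * s ^+ (i - a) *
    \sum_(c : {ffun 'I_z -> 'I_a.+1} | (\sum_(j < z) c j)%N == a)
      (a`!)%N%:R / (\prod_(j < z) (c j)`!)%N%:R * \prod_(j < z) xi (c j).

Variables (p q : nat -> R).

Definition child_law (i : nat) (m : R) (k : nat) (eta : bool) : R :=
  if i is 0%N then p0 p q k eta
  else p0 p q k eta * fweight i (m + eta%:R) k / fweight i m 1.

Definition type_law (l n : nat) (t : marked_tree) (c : seq nat -> nat) : R :=
  if (\big[addn/0]_(u \in gen t n) c u)%N == l then
    (l`!)%N%:R / (\big[muln/1]_(u \in gen t n) (c u)`!)%N%:R *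
    ((\big[*%R/1]_(u \in gen t n) (fweight (c u) (mass R t u) 1 * xi (c u))) /
     (xi l * fweight l (M n t)%:R (Z n t)))
  else 0.

Section realization.
Variables (d : measure_display) (Omega : measurableType d).
Variable Pr : probability Omega R.
Variable (tau : {RV Pr >-> mtree}).
Variable (typ : seq nat -> {RV Pr >-> nat}).

(* The tree up to generation [n] is that of [t], and the types of the nodes of
   generation less than [k] are given by [c]. *)
Definition history (n k : nat) (t : marked_tree) (c : seq nat -> nat) :
    set Omega :=
  [set w | trunc n (tau w) = trunc n t /\
           forall u, gen_lt t k u -> typ u w = c u].

(* Conditional probabilities are written as products: the conditional
   probability of [B] given [A] is [x] when [Pr (B `&` A) = Pr A * x].
   The children and marks of generation [n] are drawn given the tree up to
   generation [n] and the types of its nodes, by a law that involves only the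
   types of generation [n]; the types of generation [n.+1] are drawn given the
   tree up to generation [n.+1] and the previous types, by a law that does not
   involve the latter. The value [typ u w] is irrelevant when [u] is not a node
   of [tau w]. *)
Record is_weighted_tree (l : nat) : Prop := IsWeightedTree {
  wt_root : forall w, typ [::] w = l ;
  wt_children : forall n t c,
    Pr (history n.+1 n.+1 t c) =
    (Pr (history n n.+1 t c) *
     (\big[*%R/1]_(u \in gen t n)
        child_law (c u) (mass R t u) (nchild t u) (mark t u))%:E)%E ;
  wt_types : forall n t c, gen t n.+1 !=set0 ->
    Pr (history n.+1 n.+2 t c) =
    (Pr (history n.+1 n.+1 t c) * (type_law l n.+1 t c)%:E)%E }.

End realization.

End weights.

(* Main.v *)
(** The weights have the generating function
    [sum_i xi_i f_i(s, z) X^i / i! = exp(s X) Xi(X)^z], [Xi] being the exponential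
    generating function of the [xi_i]. Hence summing over the types of a
    generation [n] the product of the law of the types and of the laws of the
    children telescopes to a ratio of values of [f_l], evaluated at the total of
    [m_u + eta_u] and at the total number of children, that is at
    [(M_{n+1}, Z_{n+1})], because masses are transmitted entirely to the next
    generation. By induction on [n], the weighted tree gives to each cylinder of
    height [n] its probability under [P] times [f_l(M_n, Z_n)].

    Finiteness and positivity of [xi_l] come for free from [Q] having total mass
    one: at height [0] the density is [xi_l^-1 xi_l], which is [0] in the
    degenerate cases [xi_l = 0] or [xi_l] infinite (read as [0] by [fine]). *)
Require Import Defs.
From mathcomp Require Import all_boot all_order all_algebra finmap ring.
From mathcomp Require Import all_classical all_reals all_analysis.
From mathcomp Require Import measurable_realfun.
Import Order.TTheory GRing.Theory Num.Theory.
Import numFieldNormedType.Exports.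
Local Open Scope classical_set_scope.
Local Open Scope ring_scope.

Set Implicit Arguments.
Unset Strict Implicit.
Unset Printing Implicit Defensive.

(** * Exponential generating functions modulo [X^(l+1)] *)

(** Congruence modulo [X^(n+1)]: series are represented by polynomials cut at a fixed degree, so
    that identities between series survive only in this sense. *)
Definition eq_modX (R : nzRingType) (n : nat) (p q : {poly R}) :=
  forall i, (i <= n)%N -> p`_i = q`_i.

Lemma eq_modX_mul (R : nzRingType) n (p p' q q' : {poly R}) :
  eq_modX n p p' -> eq_modX n q q' -> eq_modX n (p * q) (p' * q').
Proof.
move=> pp' qq' i iln; rewrite !coefM; apply: eq_bigr => j _.
by rewrite pp' ?qq' // (leq_trans _ iln)// ?leq_subr// -ltnS.
Qed.

Lemma eq_modX_prod (R : nzRingType) n (J : Type) (r : seq J)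
    (F G : J -> {poly R}) :
  (forall j, eq_modX n (F j) (G j)) ->
  eq_modX n (\prod_(j <- r) F j) (\prod_(j <- r) G j).
Proof.
by move=> FG; apply: (big_ind2 (eq_modX n)) => // *; exact: eq_modX_mul.
Qed.

(** Cutting every factor at degree [a] leaves the coefficient unchanged and turns all factors into
    sums over the same index type ['I_a.+1], to which finite distributivity applies. *)
Lemma coef_prod (R : comNzRingType) (J : finType) (G : J -> {poly R}) a :
  (\prod_j G j)`_a =
  \sum_(c : {ffun J -> 'I_a.+1} | (\sum_j c j)%N == a) \prod_j (G j)`_(c j).
Proof.
pose G' j := \sum_(i < a.+1) (G j)`_i *: 'X^i.
have -> : (\prod_j G j)`_a = (\prod_j G' j)`_a.
  apply: (@eq_modX_prod _ a) => // j i ia.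
  by rewrite /G' -(poly_def a.+1 (fun i => (G j)`_i)) coef_poly ltnS ia.
rewrite bigA_distr_bigA /= coef_sum [RHS]big_mkcond /=; apply: eq_bigr => c _.
rewrite scaler_prod prodrXr coefZ coefXn eq_sym.
by case: eqP => _; rewrite ?mulr1 ?mulr0.
Qed.

Section egf.
Variables (R : numFieldType) (l : nat).
Implicit Types (x : nat -> R) (s : R).

Definition egf x : {poly R} := \poly_(i < l.+1) (x i / i`!%:R).

Lemma natf_neq0 n : n`!%:R != 0 :> R.
Proof. by rewrite pnatr_eq0 -lt0n fact_gt0. Qed.

Lemma egfD s s' :
  eq_modX l (egf (fun i => s ^+ i) * egf (fun i => s' ^+ i))
            (egf (fun i => (s + s') ^+ i)).
Proof.
move=> i il; rewrite coefM coef_poly ltnS il addrC exprDn mulr_suml.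
apply: eq_bigr => j _; have ji : (j <= i)%N by rewrite -ltnS.
rewrite !coef_poly !ltnS (leq_trans ji il) (leq_trans (leq_subr _ _) il).
rewrite -(bin_fact ji) !natrM -mulr_natr.
have C0 : 'C(i, j)%:R != 0 :> R by rewrite pnatr_eq0 -lt0n bin_gt0.
have := natf_neq0 j; have := natf_neq0 (i - j).
by move=> i0 j0; field; rewrite i0 j0 C0.
Qed.

(** This is [xi_i f_i(s, z)] for an arbitrary sequence [x] in place of [xi]; being free of division
    by [x i], it obeys polynomial identities without any hypothesis on [x]. *)
Definition unnormalized_weight x i s z : R :=
  \sum_(a < i.+1) 'C(i, a)%:R * s ^+ (i - a) *
    \sum_(c : {ffun 'I_z -> 'I_a.+1} | (\sum_(j < z) c j)%N == a)
      (a`!)%N%:R / (\prod_(j < z) (c j)`!)%N%:R * \prod_(j < z) x (c j).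

Lemma coef_exp_egf x s z i : (i <= l)%N ->
  (egf (fun i => s ^+ i) * egf x ^+ z)`_i =
  unnormalized_weight x i s z / i`!%:R.
Proof.
move=> il; rewrite coefMr mulr_suml; apply: eq_bigr => a _.
have ai : (a <= i)%N by rewrite -ltnS.
rewrite coef_poly ltnS (leq_trans (leq_subr _ _) il).
have -> : egf x ^+ z = \prod_(j < z) egf x by rewrite prodr_const card_ord.
rewrite coef_prod mulr_sumr [RHS]mulrAC mulr_sumr; apply: eq_bigr => c _.
under eq_bigr => j _.
  rewrite coef_poly ltnS (leq_trans _ (leq_trans ai il)); last by rewrite -ltnS.
  over.
rewrite prodf_div -natr_prod -(bin_fact ai) !natrM.
have C0 : 'C(i, a)%:R != 0 :> R by rewrite pnatr_eq0 -lt0n bin_gt0.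
have c0 : (\prod_(j < z) (c j)`!)%:R != 0 :> R.
  by rewrite natr_prod; apply/prodf_neq0 => j _; exact: natf_neq0.
have := natf_neq0 a; have := natf_neq0 (i - a).
by move=> i0 a0; field; rewrite ?i0 ?a0 ?C0 ?c0.
Qed.

Lemma egf_sum (J : Type) (r : seq J) (s : J -> R) :
  eq_modX l (\prod_(j <- r) egf (fun i => s j ^+ i))
            (egf (fun i => (\sum_(j <- r) s j) ^+ i)).
Proof.
elim: r => [|j r IH] i il.
  rewrite !big_nil coef1 coef_poly ltnS il; case: i il => [|i] _.
    by rewrite expr0 divr1.
  by rewrite expr0n mul0r.
rewrite !big_cons; apply: (etrans _ (egfD (s j) (\sum_(i <- r) s i) il)).
exact: (@eq_modX_mul _ l) il.
Qed.

(** The product over [j] of [exp(s_j X) Xi(X)^(k_j)] is [exp(S X) Xi(X)^K], where [S] and [K] are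
    the totals. Comparing the coefficients of [X^l] gives the identity, the factorials forming the
    multinomial coefficient. *)
Lemma sum_unnormalized_weight (J : finType) x (s : J -> R) (k : J -> nat) :
  \sum_(c : {ffun J -> 'I_l.+1} | (\sum_j c j)%N == l)
    l`!%:R / (\prod_j (c j)`!)%N%:R *
    \prod_j unnormalized_weight x (c j) (s j) (k j) =
  unnormalized_weight x l (\sum_j s j) (\sum_j k j)%N.
Proof.
apply: (mulIf (invr_neq0 (natf_neq0 l))).
rewrite -coef_exp_egf// -prodrXr.
have := @eq_modX_mul _ l _ _ _ _ (egf_sum (index_enum J) s) (fun i _ => erefl).
move=> /(_ (\prod_j egf x ^+ k j) l (leqnn l)) <-; rewrite -big_split /=.
rewrite coef_prod mulr_suml; apply: eq_bigr => c _.
have cl j : (c j <= l)%N by rewrite -ltnS.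
under [RHS]eq_bigr => j _ do rewrite (coef_exp_egf x (s j) (k j) (cl j)).
rewrite prodf_div -natr_prod.
have c0 : (\prod_j (c j)`!)%:R != 0 :> R.
  by rewrite natr_prod; apply/prodf_neq0 => j _; exact: natf_neq0.
by have l0 := natf_neq0 l; field; rewrite ?c0 ?l0.
Qed.

Lemma unnormalized_weight01 x : unnormalized_weight x l 0 1 = x l.
Proof.
apply: (mulIf (invr_neq0 (natf_neq0 l))); rewrite -coef_exp_egf// expr1.
have e1 : eq_modX l (egf (fun i => 0 ^+ i)) 1.
  by move=> [|i] il; rewrite coef1 coef_poly ltnS il ?divr1// expr0n mul0r.
rewrite ((eq_modX_mul e1 (fun i _ => erefl)) l)// mul1r.
by rewrite coef_poly ltnSn.
Qed.

(** For [0 < z] the coefficients of [egf x ^+ z] up to degree [l] are positive, and the exponential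
    has constant term 1 and nonnegative coefficients; hence the first term of the Cauchy product is
    positive and the others are nonnegative. *)
Lemma unnormalized_weight_gt0 x s z :
  (forall i, (i <= l)%N -> 0 < x i) -> 0 <= s -> (0 < z)%N ->
  0 < unnormalized_weight x l s z.
Proof.
move=> x0 s0 z0; rewrite -(@pmulr_lgt0 _ l`!%:R^-1); last first.
  by rewrite invr_gt0 ltr0n fact_gt0.
rewrite -coef_exp_egf//; have f0 i : 0 < i`!%:R^-1 :> R.
  by rewrite invr_gt0 ltr0n fact_gt0.
have Y0 i : (i <= l)%N -> 0 < (egf x ^+ z)`_i.
  case: z z0 => // z _; elim: z i => [|z IH] i il.
    by rewrite expr1 coef_poly ltnS il mulr_gt0// x0.
  rewrite exprS coefM big_ord_recl /=; apply: ltr_pwDl.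
    by rewrite mulr_gt0 ?subn0 ?IH// coef_poly mulr_gt0// x0.
  apply: sumr_ge0 => j _; have jl : (bump 0 j <= l)%N.
    by rewrite (leq_trans _ il)// ltn_ord.
  rewrite mulr_ge0 ?ltW ?IH ?(leq_trans (leq_subr _ _) il)//.
  by rewrite coef_poly ltnS jl mulr_gt0// x0.
rewrite coefM big_ord_recl /=; apply: ltr_pwDl.
  by rewrite subn0 mulr_gt0 ?Y0// coef_poly ltn0Sn expr0 mul1r.
apply: sumr_ge0 => j _; rewrite mulr_ge0 ?(ltW (Y0 _ _)) ?leq_subr//.
rewrite coef_poly; case: ifP => // _.
by rewrite mulr_ge0 ?exprn_ge0// ltW.
Qed.

End egf.

(** * Truncations, generations and masses *)

(** The inequality is strict for the marks because truncation erases those of level [n]. *)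
Lemma trunc_eq n t t' : trunc n t = trunc n t' <->
  (forall u, (size u <= n)%N -> node t u <-> node t' u) /\
  (forall u, (size u < n)%N -> mark t u = mark t' u).
Proof.
split=> [tt'|[nn mm]].
  have nE u : trunc_node n t u = trunc_node n t' u.
    by have /(congr1 (fun A => A u)) := congr1 node tt'.
  split=> u un.
    have := nE u; rewrite /trunc_node /= => e.
    by split=> h; [have [] : node t' u /\ (size u <= n)%N by rewrite -e|
                  have [] : node t u /\ (size u <= n)%N by rewrite e].
  have /(congr1 (fun f => f u)) := congr1 mark tt'.
  by rewrite /= /trunc_mark un !andbT.
apply: marked_tree_eq.
  by apply/seteqP; split=> u [tu un]; split=> //; exact/nn.
apply/funext => u; rewrite /= /trunc_mark; case: ltnP => un.
  by rewrite !andbT mm.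
by rewrite !andbF.
Qed.

Lemma trunc0_const t t' : trunc 0 t = trunc 0 t'.
Proof.
by apply/trunc_eq; split=> // -[|//] _; split=> _; exact: node_root.
Qed.

Lemma trunc_eq_le m n t t' : (m <= n)%N ->
  trunc n t = trunc n t' -> trunc m t = trunc m t'.
Proof.
move=> mn /trunc_eq[nn mm]; apply/trunc_eq; split=> u um.
  exact/nn/(leq_trans um).
exact/mm/(leq_trans um).
Qed.

Lemma trunc_idem n t : trunc n (trunc n t) = trunc n t.
Proof.
apply/trunc_eq; split=> u un /=; last by rewrite /trunc_mark un andbT.
by split=> [[]|].
Qed.

Lemma gen_trunc n t t' : trunc n t = trunc n t' -> gen t n = gen t' n.
Proof.
by move=> /trunc_eq[nn _]; apply/seteqP; split=> u [/nn tu un];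
  split=> //; apply: tu; rewrite un.
Qed.

Lemma Z_trunc n t t' : trunc n t = trunc n t' -> Z n t = Z n t'.
Proof. by rewrite /Z => /gen_trunc ->. Qed.

Lemma M_trunc n t t' : trunc n t = trunc n t' -> M n t = M n t'.
Proof.
move=> /trunc_eq[nn mm].
have e : gen_lt t n = gen_lt t' n.
  by apply/seteqP; split=> u [/nn tu un]; split=> //; apply/tu/ltnW.
by rewrite /M e; apply: eq_fsbigr => u; rewrite inE => -[_ un]; rewrite mm.
Qed.

Lemma gen_lt0 t : gen_lt t 0 = set0.
Proof. by apply/seteqP; split=> u []. Qed.

Lemma gen_ltS t n : gen_lt t n.+1 = gen_lt t n `|` gen t n.
Proof.
apply/seteqP; split=> u /=.
  by case=> tu; rewrite ltnS leq_eqVlt => /orP[/eqP|] ?; [right|left].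
by case=> -[tu un]; split=> //; rewrite ltnS leq_eqVlt un ?eqxx ?orbT.
Qed.

Lemma gen0 t : gen t 0 = [set [::]].
Proof.
apply/seteqP; split=> u /=; first by case=> _ /size0nil.
by move=> ->; split=> //; exact: node_root.
Qed.

Lemma no_node_above_empty_gen t n u :
  gen t n = set0 -> (n <= size u)%N -> ~ node t u.
Proof.
move=> tn nu tu; suff : gen t n (take n u) by rewrite tn.
split; last by rewrite size_takel.
rewrite -(cat_take_drop n u) in tu.
elim/last_ind: (drop n u) tu => [|s j IH]; first by rewrite cats0.
by rewrite -rcons_cat => /node_parent.
Qed.

Lemma finite_gen_lt t n : finite_set (gen_lt t n).
Proof.
elim: n => [|n IH]; first by rewrite gen_lt0.
by rewrite gen_ltS finite_setU; split=> //; exact: finite_gen.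
Qed.

(** After extinction, one more generation brings no information: neither nodes nor marks remain to
    be specified. *)
Lemma truncS_gen_empty n t t' : gen t n = set0 ->
  trunc n.+1 t' = trunc n.+1 t <-> trunc n t' = trunc n t.
Proof.
move=> tn; split; first exact: trunc_eq_le.
move=> e; have t'n : gen t' n = set0 by rewrite (gen_trunc e).
have [nn mm] := (trunc_eq _ _ _).1 e.
apply/trunc_eq; split=> u un.
  have [/nn//|/ltnW nu] := leqP (size u) n.
  split=> tu; first by case: (no_node_above_empty_gen t'n nu tu).
  by case: (no_node_above_empty_gen tn nu tu).
have [/mm//|nu] := ltnP (size u) n.
have /negPf-> : ~~ mark t' u.
  by apply/negP => /mark_node; exact: no_node_above_empty_gen t'n nu.
by apply/esym/negP => /mark_node; exact: no_node_above_empty_gen tn nu.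
Qed.

Lemma fsbig_gen_ltS (R : Type) (idx : R) (op : Monoid.com_law idx) t n
    (F : seq nat -> R) :
  \big[op/idx]_(u \in gen_lt t n.+1) F u =
  op (\big[op/idx]_(u \in gen_lt t n) F u) (\big[op/idx]_(u \in gen t n) F u).
Proof.
rewrite gen_ltS fsbigU//.
- exact: finite_gen_lt.
- exact: finite_gen.
- by move=> u [[_ un] [_ uE]]; rewrite uE ltnn in un.
Qed.

(** Generation [n.+1] is enumerated by parent, then by rank among siblings; sums and products over
    it thereby become iterated ones. *)
Lemma perm_genS t n : perm_eq (fset_set (gen t n.+1))
  [seq rcons u j | u <- fset_set (gen t n), j <- iota 1 (nchild t u)].
Proof.
apply: uniq_perm; first exact: fset_uniq.
  apply: allpairs_uniq_dep; first exact: fset_uniq.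
    by move=> u _; exact: iota_uniq.
  by move=> [u j] [v k] _ _ /= /rcons_inj[-> ->].
move=> v; rewrite in_fset_set; last exact: finite_gen.
apply/idP/allpairsPdep; rewrite inE.
  case: v / lastP => [[]//|u j [tuj]]; rewrite size_rcons => -[un].
  have tu := node_parent tuj.
  have j0 : (0 < j)%N by have /= := node_label tuj; rewrite all_rcons => /andP[].
  exists u, j; split=> //.
    by rewrite in_fset_set ?inE//; exact: finite_gen.
  by rewrite mem_iota j0 add1n ltnS; apply/(nchildP tu).
move=> [u [j [+ + ->]]]; rewrite in_fset_set ?inE; last exact: finite_gen.
move=> [tu un]; rewrite mem_iota add1n ltnS => /andP[j0 jk].
by split; [exact/nchildP|rewrite size_rcons un].
Qed.

Lemma big_genS (R : Type) (idx : R) (op : Monoid.com_law idx) t n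
    (F : seq nat -> R) :
  \big[op/idx]_(v \in gen t n.+1) F v =
  \big[op/idx]_(u \in gen t n)
    \big[op/idx]_(1 <= j < (nchild t u).+1) F (rcons u j).
Proof.
rewrite !fsbig_finite; try exact: finite_gen.
rewrite (perm_big _ (perm_genS t n)) big_allpairs_dep /=.
by apply: eq_bigr => u _; rewrite /index_iota subSS subn0.
Qed.

Lemma ZE n t : Z n t = (\big[addn/0]_(u \in gen t n) 1)%N.
Proof.
rewrite fsbig_finite; last exact: finite_gen.
by rewrite sum1_size.
Qed.

Lemma Z_gt0 n t : gen t n !=set0 -> (0 < Z n t)%N.
Proof.
move=> [u tu]; rewrite /Z cardfs_gt0; apply/fset0Pn; exists u.
by rewrite in_fset_set ?inE//; exact: finite_gen.
Qed.

Lemma Z_eq0 n t : gen t n = set0 -> Z n t = 0%N.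
Proof. by move=> e; rewrite /Z e fset_set0 cardfs0. Qed.

Lemma ZS n t : Z n.+1 t = (\big[addn/0]_(u \in gen t n) nchild t u)%N.
Proof.
rewrite ZE big_genS; apply: eq_fsbigr => u _.
by rewrite sum_nat_const_nat subSS subn0 muln1.
Qed.

Lemma natr_fsum (R : numDomainType) (I : choiceType) (D : set I)
    (F : I -> nat) : finite_set D ->
  (\big[addn/0%N]_(i \in D) F i)%:R = \sum_(i \in D) ((F i)%:R : R).
Proof.
move=> fD; rewrite (fsbig_finite addn)//= natr_sum.
by rewrite [RHS]fsbig_finite.
Qed.

(** * Conservation of the total mass from one generation to the next *)

Section mass.
Variables (R : realType) (t : marked_tree).

Lemma mass_at_ge0 n u : 0 <= mass_at R t n u.
Proof.
elim: n u => [//|n IH] u /=; apply: addr_ge0.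
  by rewrite divr_ge0// addr_ge0.
rewrite divr_ge0//; apply: sumr_ge0 => w _.
by rewrite addr_ge0.
Qed.

Lemma mass_ge0 u : 0 <= mass R t u. Proof. exact: mass_at_ge0. Qed.

(** A node with children divides its mass and mark among them, and what the childless nodes hold is
    divided among all of generation [n.+1]. The latter must be nonempty, otherwise that mass
    disappears. *)
Lemma sum_massS n : (0 < Z n.+1 t)%N ->
  \sum_(v \in gen t n.+1) mass R t v =
  \sum_(u \in gen t n) (mass R t u + (mark t u)%:R).
Proof.
move=> Z0; rewrite big_genS.
pose lost := \sum_(w \in gen t n `&` [set w | nchild t w = 0%N])
  (mass R t w + (mark t w)%:R).
(* The children of [u] are grouped: together they receive what [u] holds, or nothing if there are
   none, plus one share of [lost] each. *)
transitivity (\sum_(u \in gen t n)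
    ((if nchild t u == 0%N then 0 else mass R t u + (mark t u)%:R) +
     (nchild t u)%:R * (lost / (Z n.+1 t)%:R))).
  apply: eq_fsbigr => u; rewrite inE => tu.
  transitivity (\sum_(1 <= j < (nchild t u).+1)
      ((mass R t u + (mark t u)%:R) / (nchild t u)%:R + lost / (Z n.+1 t)%:R)).
    by apply: eq_big_nat => j jk; rewrite (mass_child _ tu).
  rewrite sumr_const_nat subSS subn0 mulrnDl mulr_natl; congr (_ + _).
  case: eqP => [->//|/eqP k0].
  by rewrite -[LHS]mulr_natr divfK// pnatr_eq0.
rewrite fsbig_split/=; last exact: finite_gen.
rewrite -mulr_fsuml.
have -> : \sum_(u \in gen t n) ((nchild t u)%:R : R) = (Z n.+1 t)%:R.
  by rewrite ZS natr_fsum//; exact: finite_gen.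
rewrite mulrC divfK ?pnatr_eq0 -?lt0n//.
(* Separating the childless nodes on both sides shows that [lost] is exactly their contribution on
   the right. *)
rewrite [RHS](fsbigID [set w | nchild t w = 0%N]); last exact: finite_gen.
rewrite [X in X + _ = _](fsbigID [set w | nchild t w = 0%N]).
  2: exact: finite_gen.
rewrite fsbig1 ?add0r => [|u [_ /= ->]]; last by rewrite eqxx.
rewrite addrC; congr (_ + _); rewrite /= add0r; apply: eq_fsbigr => u.
rewrite inE => -[_ /eqP].
by move=> /negPf ->.
Qed.

Lemma MS n : (M n.+1 t)%:R =
  (M n t)%:R + \sum_(u \in gen t n) ((mark t u)%:R : R).
Proof.
rewrite {1}/M fsbig_gen_ltS natrD; congr (_ + _).
by rewrite natr_fsum//; exact: finite_gen.
Qed.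

Lemma sum_mass n : gen t n !=set0 ->
  \sum_(u \in gen t n) mass R t u = (M n t)%:R.
Proof.
elim: n => [|n IH] tn.
  by rewrite gen0 fsbig_set1 mass_root /M gen_lt0 fsbig_set0.
rewrite sum_massS; last exact: Z_gt0.
rewrite fsbig_split/=; last exact: finite_gen.
rewrite IH -?MS//; apply/set0P/negP => /eqP tn0; case: tn => u [tu un].
by apply: (no_node_above_empty_gen tn0) tu; rewrite un.
Qed.

Lemma sum_mass_mark n : gen t n !=set0 ->
  \sum_(u \in gen t n) (mass R t u + (mark t u)%:R) = (M n.+1 t)%:R.
Proof.
move=> tn; rewrite fsbig_split/=; last exact: finite_gen.
by rewrite sum_mass// MS.
Qed.

End mass.

(** * Measures and countable partitions *)

Lemma measurable_fiber_pieces d (T : measurableType d) (C : countType)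
    (f : T -> C) (A : set T) k :
  (forall c, measurable (A `&` f @^-1` [set c])) ->
  measurable (if @pickle_inv C k is Some c then A `&` f @^-1` [set c] else set0).
Proof. by move=> mf; case: pickle_inv. Qed.

(** Countable additivity over the fibers of [f], enumerated through the partial inverse of the
    coding of [C]. Only the pieces are assumed measurable; [A] is their union. *)
Lemma measure_fibers d (T : measurableType d) (R : realType)
    (mu : {measure set T -> \bar R}) (C : countType) (f : T -> C) (A : set T) :
  (forall c, measurable (A `&` f @^-1` [set c])) ->
  (mu A = \sum_(0 <= k <oo) if @pickle_inv C k is Some c
                            then mu (A `&` f @^-1` [set c]) else 0)%E.
Proof.
move=> mf.
pose F k := if @pickle_inv C k is Some c then A `&` f @^-1` [set c] else set0.
have AE : A = \bigcup_k F k.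
  apply/seteqP; split=> x.
  2: by case=> k _; rewrite /F; case: pickle_inv => // c [].
  by move=> Ax; exists (choice.pickle (f x)) => //; rewrite /F pickleK_inv.
have mF k : measurable (F k) by exact: measurable_fiber_pieces.
rewrite {1}AE measure_semi_bigcup//=.
- by apply: eq_eseriesr => k _; rewrite /F; case: pickle_inv.
- move=> i j _ _ [x []]; rewrite /F.
  have := @pickle_invK C i; have := @pickle_invK C j.
  by case: pickle_inv => // c /= <-; case: pickle_inv => // c' /= <- [_ ->] [_ ->].
- exact: bigcupT_measurable.
Qed.

(** A common ratio on the pieces passes to the countable sum. It serves with [x] a conditional
    probability, and with [x = 1] to compare two measures. *)
Lemma eq_measure_fibers d d' (T : measurableType d) (T' : measurableType d')
    (R : realType) (mu : {measure set T -> \bar R})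
    (mu' : {measure set T' -> \bar R}) (C : countType) (f : T -> C)
    (f' : T' -> C) (A : set T) (A' : set T') (x : R) :
  (forall c, measurable (A `&` f @^-1` [set c])) ->
  (forall c, measurable (A' `&` f' @^-1` [set c])) ->
  (forall c, mu (A `&` f @^-1` [set c]) =
     mu' (A' `&` f' @^-1` [set c]) * x%:E)%E ->
  (mu A = mu' A' * x%:E)%E.
Proof.
move=> mf mf' ff'; rewrite (measure_fibers mu mf) (measure_fibers mu' mf').
rewrite muleC -nneseriesZl; last by move=> k _; case: pickle_inv.
apply: eq_eseriesr => k _; case: pickle_inv => [c|]; last by rewrite mule0.
by rewrite ff' muleC.
Qed.

(** If finitely many disjoint pieces fill [A0] up to a null set, they also fill any subset [A]. This
    allows only type vectors of total [l] to be considered: the others have probability zero already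
    before the children are drawn. *)
Lemma measure_sum_full_pieces d (T : measurableType d) (R : realType)
    (mu : {finite_measure set T -> \bar R}) (I : finType) (J : pred I)
    (A A0 : set T)
    (S : I -> set T) :
  measurable A -> measurable A0 -> (forall i, measurable (S i)) ->
  trivIset setT S -> A `<=` A0 ->
  (mu A0 = \sum_(i | J i) mu (A0 `&` S i))%E ->
  (mu A = \sum_(i | J i) mu (A `&` S i))%E.
Proof.
move=> mA mA0 mS tS AA0.
pose U := \bigcup_(i in [set` enum J]) S i.
have mU : measurable U by apply: fin_bigcup_measurable => // i _.
have sumE B : measurable B -> (\sum_(i | J i) mu (B `&` S i) = mu (B `&` U))%E.
  move=> mB; rewrite -big_enum /= fsbig_seq ?enum_uniq//.
  rewrite -(measure_fin_bigcup mu) ?setI_bigcupr//.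
  - by move=> i j _ _ [x [[_ ?] [_ ?]]]; apply: tS => //; exists x.
  - by move=> i _; exact: measurableI.
rewrite !sumE// => e; apply: etrans (measureDI mu mA mU) _.
rewrite -[RHS]add0e; congr (_ + _)%E.
have mAU : measurable (A `\` U) by exact: measurableD.
have mA0U : measurable (A0 `\` U) by exact: measurableD.
apply/eqP; rewrite eq_le measure_ge0 andbT.
have <- : mu (A0 `\` U) = 0%E.
  have := etrans (esym e) (measureDI mu mA0 mU).
  move=> /(congr1 (fun x => x - mu (A0 `&` U)))%E.
  by rewrite addeK ?subee ?fin_num_measure//; exact: measurableI.
by apply: le_measure; rewrite ?inE//; exact: setSD.
Qed.

(** * The filtration, its cylinders, and a countable coding of truncated trees *)

Lemma filtration_measurable n (A : set mtree) : filtration n A -> measurable A.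
Proof. by move=> nA; apply: sub_sigma_algebra; exists n. Qed.

Lemma filtrationP n (A : set marked_tree) :
  (forall t t', trunc n t = trunc n t' -> A t -> A t') -> filtration n A.
Proof.
move=> An; exists A => //; rewrite setTI; apply/seteqP; split=> t /=.
  by apply: An; exact: trunc_idem.
by apply: An; rewrite trunc_idem.
Qed.

Lemma filtration_inv n (A : set marked_tree) t t' :
  filtration n A -> trunc n t = trunc n t' -> A t -> A t'.
Proof. by move=> [B _ <-] tt' [_ /=]; rewrite tt'; split. Qed.

Definition cylinder n t : set mtree := [set t' | trunc n t' = trunc n t].

Lemma cylinder_filtration n t : filtration n (cylinder n t).
Proof. by apply: filtrationP => t1 t2; rewrite /cylinder /= => ->. Qed.

Lemma measurable_trunc_fun n d (T : measurableType d) (g : mtree -> T) :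
  (forall t t', trunc n t = trunc n t' -> g t = g t') -> measurable_fun setT g.
Proof.
move=> gn _ Y mY; rewrite setTI; apply: (@filtration_measurable n).
by apply: filtrationP => t t' /gn /= ->.
Qed.

Lemma filtration_le m n A : (m <= n)%N -> filtration m A -> filtration n A.
Proof.
move=> mn mA; apply: filtrationP => t t' tt'.
by apply: (filtration_inv mA); exact: trunc_eq_le tt'.
Qed.

(** Truncated trees are finite objects, recorded here in a countable type by their finite sets of
    nodes and of marked nodes, so that fibers can be summed over. *)
Definition trunc_code n (t : marked_tree) : {fset seq nat} * {fset seq nat} :=
  (fset_set (trunc_node n t), fset_set [set u | trunc_mark n t u]).

Lemma trunc_code_inj n t t' :
  trunc_code n t = trunc_code n t' <-> trunc n t = trunc n t'.
Proof.
have fn s : finite_set (trunc_node n s).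
  apply: sub_finite_set (finite_gen_lt s n.+1).
  by move=> u [su un]; split; rewrite ?ltnS.
have fm s : finite_set [set u | trunc_mark n s u].
  by apply: sub_finite_set (fn s) => u /trunc_mark_node.
split=> [[]|tt'].
  move=> /fset_set_inj => /(_ (fn t) (fn t')) en.
  move=> /fset_set_inj => /(_ (fm t) (fm t')) em.
  apply: marked_tree_eq => //; apply/funext => u.
  by apply/idP/idP; move/(congr1 (fun A => A u)): em => /= ->.
have := congr1 node tt'; have := congr1 mark tt'; rewrite /= /trunc_code => -> ->.
by [].
Qed.

(** * The constants [xi_i] and the weights [f_i] *)

Section moments.
Variables (R : realType) (P : probability mtree R).

Definition moment i n : \bar R := (\int[P]_t ((M n t)%:R ^+ i)%:E)%E.

Lemma measurable_M_exp i n :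
  @measurable_fun _ _ mtree (\bar R) setT (fun t => ((M n t)%:R ^+ i)%:E).
Proof. by refine (measurable_trunc_fun (n := n) _) => t t' /M_trunc ->. Qed.

(** Since [M] is nondecreasing in [n], the moments increase, and their limit is a supremum whether
    finite or not. *)
Lemma xiE i : xi P i = fine (ereal_sup (range (moment i))).
Proof.
rewrite /xi (_ : (fun n => 'E_P[_]%E) = moment i); last first.
  by apply/funext => n; rewrite unlock.
congr fine; apply: cvg_lim => //.
apply: ereal_nondecreasing_cvgn => m n mn; apply: ge0_le_integral => //.
- exact: measurable_M_exp.
- exact: measurable_M_exp.
move=> t _; rewrite lee_fin lerXn2r ?nnegrE// ler_nat.
elim: n mn => [|n IH]; first by rewrite leqn0 => /eqP ->.
rewrite leq_eqVlt => /orP[/eqP ->//|/IH/leq_trans]; apply.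
by rewrite /M fsbig_gen_ltS leq_addr.
Qed.

(** Pointwise, [m^i <= 1 + m^l] for a natural number [m]; the case [m = 0] is separate because
    [0^0 = 1]. *)
Lemma moment_le l i n : (i <= l)%N -> (moment i n <= 1 + moment l n)%E.
Proof.
move=> il.
have m1 : @measurable_fun _ _ mtree (\bar R) setT (fun _ => 1%:E) by [].
have mM j := measurable_M_exp j n.
have -> : (1 = \int[P]_t (cst 1%:E t))%E.
  by rewrite integral_cst// mul1e; exact/esym/probability_setT.
rewrite -ge0_integralD//.
apply: ge0_le_integral => //.
- exact: emeasurable_funD.
move=> t _; rewrite -EFinD lee_fin; case: (M n t) => [|m].
  by rewrite ler_wpDr ?exprn_ge0// exprn_ile1.
by rewrite ler_wpDl// ler_weXn2l// ler1n.
Qed.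

(** A null moment means that [M_n^i] vanishes almost surely; then [i] is positive and [M_n] itself
    vanishes almost surely. *)
Lemma moment_eq0 l i n : (i <= l)%N -> moment i n = 0%E -> moment l n = 0%E.
Proof.
move=> il.
have mM j := measurable_M_exp j n.
have abs j : moment j n = (\int[P]_t `|((M n t)%:R ^+ j)%:E|)%E.
  by apply: eq_integral => t _; rewrite gee0_abs// lee_fin exprn_ge0.
rewrite !abs => /(ae_eq_integral_abs P measurableT (mM i)) Mi.
apply/(ae_eq_integral_abs P measurableT (mM l)).
apply: filterS Mi => t Mi _; have /= [] := Mi I.
move/eqP; rewrite expf_eq0 => /andP[i0 /eqP ->].
by rewrite expr0n gtn_eqF// (leq_trans i0).
Qed.

(** As [fine] sends infinity to 0, [xi P l != 0] says both that the moments of order [l] are bounded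
    and that they are not all null. [moment_le] carries boundedness down to order [i], and
    [moment_eq0] positivity. *)
Lemma xi_gt0 l i : xi P l != 0 -> (i <= l)%N -> 0 < xi P i.
Proof.
rewrite !xiE => xl0 il.
have sup_ge0 j n : (moment j n <= ereal_sup (range (moment j)))%E.
  by apply: ereal_sup_ubound; exists n.
have m0 j n : (0 <= moment j n)%E.
  by apply: integral_ge0 => t _; rewrite lee_fin exprn_ge0.
have Lfin : ereal_sup (range (moment l)) \is a fin_num.
  by apply: contraNT xl0; case: ereal_sup.
have iltoo : (ereal_sup (range (moment i)) < +oo)%E.
  apply: (@le_lt_trans _ _ (1 + ereal_sup (range (moment l)))%E).
    apply: ge_ereal_sup => _ [n _ <-]; apply: le_trans (moment_le n il) _.
    exact: leeD2l.
  by apply: lte_add_pinfty; [exact: ltry|rewrite ltey_eq Lfin].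
apply: fine_gt0; rewrite iltoo andbT lt_neqAle (le_trans (m0 i 0) (sup_ge0 i 0)).
rewrite andbT; apply: contraNneq xl0 => i0.
suff -> : ereal_sup (range (moment l)) = 0%E by [].
apply/eqP; rewrite eq_le (le_trans (m0 l 0) (sup_ge0 l 0)) andbT.
apply: ge_ereal_sup => _ [n _ <-]; rewrite (moment_eq0 il)//.
by apply/eqP; rewrite eq_le m0 andbT i0.
Qed.

End moments.

Lemma fweightE (R : realType) (P : probability mtree R) i s z :
  fweight P i s z = (xi P i)^-1 * unnormalized_weight (xi P) i s z.
Proof. by []. Qed.

Lemma big_genE (R : Type) (idx : R) (op : Monoid.com_law idx) t n
    (F : seq nat -> R) :
  \big[op/idx]_(u \in gen t n) F u =
  \big[op/idx]_(j : fset_set (gen t n)) F (val j).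
Proof. by rewrite fsbig_finite ?big_seq_fsetE//; exact: finite_gen. Qed.

(** * Summation over the types of one generation *)

Section laws.
Variables (R : realType) (P : probability mtree R) (l : nat).
Hypothesis xi_pos : forall i, (i <= l)%N -> 0 < xi P i.

Lemma xi0 : xi P 0 = 1.
Proof.
rewrite xiE (_ : range _ = [set 1%E]) ?ereal_sup1//.
have m1 n : moment P 0 n = 1%E.
  rewrite /moment; under eq_integral do rewrite expr0.
  by rewrite integral_cst// mul1e; exact: probability_setT.
by apply/seteqP; split=> x /=; [case=> n _ <-|move=> ->; exists 0%N].
Qed.

Lemma fweight0 s z : fweight P 0 s z = 1.
Proof.
rewrite fweightE xi0 invr1 mul1r.
have := coef_exp_egf (xi P) s z (leqnn 0); rewrite divr1 => <-.
rewrite -horner_coef0 hornerM horner_exp !horner_coef0 !coef_poly /=.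
by rewrite xi0 expr0 !divr1 expr1n mulr1.
Qed.

Lemma fweight01 : fweight P l 0 1 = 1.
Proof. by rewrite fweightE unnormalized_weight01 mulVf// gt_eqF// xi_pos. Qed.

Lemma fweight_gt0 i s z : (i <= l)%N -> 0 <= s -> (0 < z)%N ->
  0 < fweight P i s z.
Proof.
move=> il s0 z0; rewrite fweightE mulr_gt0 ?invr_gt0 ?xi_pos//.
by apply: unnormalized_weight_gt0 => // j ji; apply: xi_pos; exact: leq_trans il.
Qed.

(** The factors [xi P (c j)] clear the normalizations of the weights, which reduces the sum to the
    generating function identity. *)
Lemma sum_fweight (J : finType) (s : J -> R) (k : J -> nat) :
  \sum_(c : {ffun J -> 'I_l.+1} | (\sum_j c j)%N == l)
    l`!%:R / (\prod_j (c j)`!)%N%:R *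
    \prod_j (fweight P (c j) (s j) (k j) * xi P (c j)) =
  xi P l * fweight P l (\sum_j s j) (\sum_j k j)%N.
Proof.
have xi_neq0 i : (i <= l)%N -> xi P i != 0 by move=> il; rewrite gt_eqF ?xi_pos.
rewrite fweightE mulVKf ?xi_neq0// -sum_unnormalized_weight.
apply: eq_bigr => c _; congr (_ * _); apply: eq_bigr => j _.
by rewrite fweightE mulrC mulVKf// xi_neq0// -ltnS.
Qed.

Variables (p q : nat -> R).

(** Type 0 is no exception to the general formula, because [f_0 = 1]. *)
Lemma child_lawE i m k eta :
  child_law P p q i m k eta =
  p0 p q k eta * fweight P i (m + eta%:R) k / fweight P i m 1.
Proof. by case: i => //=; rewrite !fweight0 mulr1 divr1. Qed.

Variables (n : nat) (t : marked_tree).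
Let J := fset_set (gen t n).

(** Types of total [l] are at most [l], so they range over a finite type of functions; the value 0
    off generation [n] is a mere default. *)
Definition extend_types (c : {ffun J -> 'I_l.+1}) (u : seq nat) : nat :=
  if insub u is Some j then c j else 0%N.

Lemma extend_typesE c (j : J) : extend_types c (val j) = c j.
Proof. by rewrite /extend_types valK. Qed.

Lemma type_law_extend_types (c : {ffun J -> 'I_l.+1}) : (\sum_j c j)%N == l ->
  type_law P l n t (extend_types c) =
  l`!%:R / (\prod_j (c j)`!)%N%:R *
  \prod_j (fweight P (c j) (mass R t (val j)) 1 * xi P (c j)) /
  (xi P l * fweight P l (M n t)%:R (Z n t)).
Proof.
move=> /eqP cl; rewrite /type_law !big_genE.
have extE (T : Type) (idx : T) (op : Monoid.com_law idx) (F : nat -> J -> T) :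
    \big[op/idx]_j F (extend_types c (val j)) j = \big[op/idx]_j F (c j) j.
  by apply: eq_bigr => j _; rewrite extend_typesE.
rewrite (extE _ _ _ (fun i _ => i)) cl eqxx.
rewrite (extE _ _ _ (fun i _ => i`!)).
by rewrite (extE _ _ _ (fun i j => fweight P i (mass R t (val j)) 1 * xi P i)) mulrA.
Qed.

Hypothesis gen_neq0 : gen t n !=set0.

Let denominator_neq0 : xi P l * fweight P l (M n t)%:R (Z n t) != 0.
Proof.
by rewrite mulf_neq0// gt_eqF ?xi_pos// fweight_gt0//; exact: Z_gt0.
Qed.

(** With one slot per node, the totals are [Z_n] and, by conservation of mass, [M_n]: the sum is the
    normalizing denominator. *)
Lemma sum_type_law :
  \sum_(c : {ffun J -> 'I_l.+1} | (\sum_j c j)%N == l)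
    type_law P l n t (extend_types c) = 1.
Proof.
under eq_bigr => c cl do rewrite type_law_extend_types//.
rewrite -mulr_suml (sum_fweight (fun j : J => mass R t (val j)) (fun=> 1%N)).
have -> : \sum_(j : J) mass R t (val j) = (M n t)%:R.
  by rewrite -sum_mass// big_genE.
have -> : (\sum_(j : J) 1)%N = Z n t by rewrite ZE big_genE.
by rewrite divff.
Qed.

Lemma sum_type_child_law :
  \sum_(c : {ffun J -> 'I_l.+1} | (\sum_j c j)%N == l)
    (type_law P l n t (extend_types c) * \big[*%R/1]_(u \in gen t n)
      child_law P p q (extend_types c u) (mass R t u) (nchild t u) (mark t u)) =
  \big[*%R/1]_(u \in gen t n) p0 p q (nchild t u) (mark t u) *
  fweight P l (M n.+1 t)%:R (Z n.+1 t) / fweight P l (M n t)%:R (Z n t).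
Proof.
have sE : \sum_(j : J) (mass R t (val j) + (mark t (val j))%:R) = (M n.+1 t)%:R.
  by rewrite -sum_mass_mark// big_genE.
have kE : (\sum_(j : J) nchild t (val j))%N = Z n.+1 t by rewrite ZS big_genE.
rewrite -sE -kE.
transitivity (\prod_(j : J) p0 p q (nchild t (val j)) (mark t (val j)) *
    (xi P l * fweight P l (\sum_(j : J) (mass R t (val j) + (mark t (val j))%:R))
      (\sum_(j : J) nchild t (val j))%N) /
    (xi P l * fweight P l (M n t)%:R (Z n t))).
  rewrite -(sum_fweight (fun j : J => mass R t (val j) + (mark t (val j))%:R)
    (fun j => nchild t (val j))).
  rewrite mulr_sumr mulr_suml; apply: eq_bigr => c cl.
  (* Node by node, the factor [f_(c j)(m, 1)] of the law of the types cancels the denominator of the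
     law of the children. *)
  rewrite type_law_extend_types// big_genE /=.
  rewrite [LHS]mulrAC; congr (_ / _); rewrite -[LHS]mulrA [RHS]mulrCA; congr (_ * _).
  rewrite -!big_split/=; apply: eq_bigr => j _; rewrite extend_typesE child_lawE.
  have f0 : fweight P (c j) (mass R t (val j)) 1 != 0.
    by rewrite gt_eqF// fweight_gt0// ?mass_ge0// -ltnS.
  by field.
rewrite big_genE; move: denominator_neq0; rewrite mulf_eq0 negb_or => /andP[x0 f0].
by field; rewrite ?x0 ?f0.
Qed.

End laws.

(** * The law of the weighted tree *)

Section weighted_tree.
Variables (R : realType) (P : probability mtree R) (p q : nat -> R) (l : nat).
Variables (d : measure_display) (Omega : measurableType d).
Variables (Pr : probability Omega R) (tau : {RV Pr >-> mtree}).
Variable typ : seq nat -> {RV Pr >-> nat}.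

Definition tree_event n t : set Omega := tau @^-1` cylinder n t.

Definition types_event (D : set (seq nat)) (c : seq nat -> nat) : set Omega :=
  [set w | forall u, D u -> typ u w = c u].

Lemma measurable_tree_event n t : measurable (tree_event n t).
Proof.
rewrite -[tree_event _ _]setTI.
have mtau : measurable_fun setT tau by [].
apply: mtau => //; exact: filtration_measurable (cylinder_filtration n t).
Qed.

Lemma measurable_types_event D c : finite_set D -> measurable (types_event D c).
Proof.
move=> fD; rewrite (_ : types_event D c = \bigcap_(u in D) typ u @^-1` [set c u])//.
apply: fin_bigcap_measurable => // u _.
have mtyp : measurable_fun setT (typ u) by [].
by rewrite -[_ @^-1` _]setTI; exact: mtyp.
Qed.

(** Total probability over the types carried by a finite set of nodes: a conditional probability
    that does not depend on these types remains valid without them. *)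
Lemma marginalize_types (A B : set Omega) (D : set (seq nat)) (x : R) :
  measurable A -> measurable B -> finite_set D ->
  (forall c, Pr (A `&` types_event D c) = Pr (B `&` types_event D c) * x%:E)%E ->
  (Pr A = Pr B * x%:E)%E.
Proof.
move=> mA mB fD AB; pose s := enum_fset (fset_set D).
pose f w := [seq typ u w | u <- s].
have fE a : f @^-1` [set a] = set0 \/ exists c, f @^-1` [set a] = types_event D c.
  (* A nonempty fiber is the event that prescribes the types observed at any one of its points. *)
  have [[w0 fw0]|no] := pselect (exists w, f w = a); last first.
    by left; apply/seteqP; split=> // w /= fw; apply: no; exists w.
  right; exists (fun u => typ u w0); rewrite -fw0; apply/seteqP; split=> w /=.
    by move=> /eq_in_map fw u Du; apply: fw; rewrite in_fset_set// inE.
  move=> fw; apply/eq_in_map => u; rewrite in_fset_set// inE.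
  exact: fw.
have mf C a : measurable C -> measurable (C `&` f @^-1` [set a]).
  move=> mC; apply: measurableI => //; have [->//|[c ->]] := fE a.
  exact: measurable_types_event.
apply: (eq_measure_fibers (f := f) (f' := f)) => a; [exact: mf|exact: mf|].
by have [->|[c ->]] := fE a; [rewrite !setI0 !measure0 mul0e|exact: AB].
Qed.

Hypothesis wt : is_weighted_tree P p q tau typ l.

Lemma historyE n k t c :
  history tau typ n k t c = tree_event n t `&` types_event (gen_lt t k) c.
Proof. by []. Qed.

Lemma children_given_types n t c :
  (Pr (tree_event n.+1 t `&` types_event (gen t n) c) =
   Pr (tree_event n t `&` types_event (gen t n) c) *
   (\big[*%R/1]_(u \in gen t n)
      child_law P p q (c u) (mass R t u) (nchild t u) (mark t u))%:E)%E.
Proof.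
have mT : measurable (types_event (gen t n) c).
  exact/measurable_types_event/finite_gen.
apply: (marginalize_types (D := gen_lt t n)).
- by apply: measurableI => //; exact: measurable_tree_event.
- by apply: measurableI => //; exact: measurable_tree_event.
- exact: finite_gen_lt.
(* [c'] glues the earlier types [c0] to the types [c] of generation [n], so that the intersection of
   events is a history. *)
move=> c0; pose c' u := if (size u < n)%N then c0 u else c u.
have cE m : tree_event m t `&` types_event (gen t n) c `&`
    types_event (gen_lt t n) c0 =
    history tau typ m n.+1 t c'.
  rewrite historyE gen_ltS -setIA; congr (_ `&` _); apply/seteqP; split=> w /=.
    move=> [wc wc0] u; rewrite /c' => -[[tu un]|[tu un]].
      by rewrite un wc0.
    by rewrite un ltnn wc.
  move=> wc'; split=> u [tu un].
    by have := wc' u; rewrite /c' un ltnn; apply; right.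
  by have := wc' u; rewrite /c' un; apply; left.
rewrite !cE (wt_children wt); congr (_ * _%:E)%E.
by apply: eq_fsbigr => u; rewrite inE => -[_ un]; rewrite /c' un ltnn.
Qed.

(** The root has a deterministic type, so generation 0 is checked directly: the law is 1 at [l] and
    0 elsewhere. For later generations the earlier types are summed out of [wt_types]. *)
Lemma types_given_tree n t c : gen t n !=set0 ->
  xi P l != 0 -> fweight P l 0 1 != 0 ->
  (Pr (tree_event n t `&` types_event (gen t n) c) =
   Pr (tree_event n t) * (type_law P l n t c)%:E)%E.
Proof.
case: n => [_ xl0 fl0|n tn _ _].
  rewrite /type_law gen0 !fsbig_set1 mass_root.
  have -> : M 0 t = 0%N by rewrite /M gen_lt0 fsbig_set0.
  have -> : Z 0 t = 1%N by rewrite ZE gen0 fsbig_set1.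
  case: eqP => [cl|cl].
    have -> : l`!%:R / (c [::])`!%:R * (fweight P (c [::]) 0 1 * xi P (c [::]) /
        (xi P l * fweight P l 0 1)) = 1 :> R.
      by rewrite cl; field; apply/and3P; split=> //; exact: natf_neq0.
    rewrite mule1; congr (Pr _); apply/setIidPl => w _ u ->.
    by rewrite (wt_root wt) cl.
  rewrite mule0 (_ : _ `&` _ = set0) ?measure0//; apply/seteqP; split=> // w [_].
  by move=> /(_ [::] erefl); rewrite (wt_root wt) => /esym.
have mT := measurable_tree_event n.+1 t.
have mg : measurable (types_event (gen t n.+1) c).
  exact/measurable_types_event/finite_gen.
apply: (marginalize_types (D := gen_lt t n.+1)) => //.
- exact: measurableI.
- exact: finite_gen_lt.
move=> c0; pose c' u := if (size u < n.+1)%N then c0 u else c u.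
have -> : tree_event n.+1 t `&` types_event (gen_lt t n.+1) c0 =
    history tau typ n.+1 n.+1 t c'.
  rewrite historyE; congr (_ `&` _); apply/seteqP; split=> w /= wc u tu.
    by rewrite /c' tu.2 wc.
  by rewrite wc// /c' tu.2.
have -> : tree_event n.+1 t `&` types_event (gen t n.+1) c `&`
    types_event (gen_lt t n.+1) c0 = history tau typ n.+1 n.+2 t c'.
  rewrite historyE (gen_ltS t n.+1) -setIA; congr (_ `&` _).
  apply/seteqP; split=> w /=.
    move=> [wc wc0] u; rewrite /c' => -[[tu un]|[tu un]].
      by rewrite un wc0.
    by rewrite un ltnn wc.
  move=> wc'; split=> u [tu un].
    by have := wc' u; rewrite /c' un ltnn; apply; right.
  by have := wc' u; rewrite /c' un; apply; left.
rewrite (wt_types wt)//; congr (_ * _%:E)%E.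
have cE u : gen t n.+1 u -> c' u = c u by move=> [_ un]; rewrite /c' un ltnn.
rewrite /type_law.
by congr (if _ == _ then _ / _%:R * (_ / _) else _);
  apply: eq_fsbigr => u; rewrite inE => /cE ->.
Qed.

Hypothesis xi_pos : forall i, (i <= l)%N -> 0 < xi P i.

Lemma prob_tree_event n t :
  (Pr (tree_event n t) =
   (\big[*%R/1]_(u \in gen_lt t n) p0 p q (nchild t u) (mark t u) *
    fweight P l (M n t)%:R (Z n t))%:E)%E.
Proof.
elim: n => [|n IH].
  rewrite gen_lt0 fsbig_set0 mul1r.
  have -> : M 0 t = 0%N by rewrite /M gen_lt0 fsbig_set0.
  have -> : Z 0 t = 1%N by rewrite ZE gen0 fsbig_set1.
  rewrite fweight01// (_ : tree_event _ _ = setT) ?probability_setT//.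
  by apply/seteqP; split=> // w _; exact: trunc0_const.
(* On an extinct tree no types are drawn; the event, the product, [M] and [Z] are all unchanged from
   height [n] to [n.+1]. *)
have [tn0|/set0P tn] := eqVneq (gen t n) set0.
  have -> : tree_event n.+1 t = tree_event n t.
    by apply/seteqP; split=> w /(truncS_gen_empty _ tn0).
  rewrite IH fsbig_gen_ltS /M fsbig_gen_ltS tn0 !fsbig_set0 /= mulr1 addn0.
  rewrite (Z_eq0 tn0) Z_eq0//; apply/seteqP; split=> // u [tu un].
  by apply: (no_node_above_empty_gen tn0) tu; rewrite un.
have x0 : xi P l != 0 by rewrite gt_eqF// xi_pos.
have f0 : fweight P l 0 1 != 0 by rewrite fweight01// oner_eq0.
have given c := types_given_tree c tn x0 f0.
pose S (c : {ffun fset_set (gen t n) -> 'I_l.+1}) :=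
  types_event (gen t n) (extend_types c).
pose J (c : {ffun fset_set (gen t n) -> 'I_l.+1}) := (\sum_j c j)%N == l.
have mS c : measurable (S c) by exact/measurable_types_event/finite_gen.
have tS : trivIset setT S.
  move=> c c' _ _ [w [wc wc']]; apply/ffunP => j; apply: val_inj => /=.
  rewrite -!extend_typesE -(wc (val j)) -?(wc' (val j))//.
    by have := valP j; rewrite in_fset_set ?inE//; exact: finite_gen.
  by have := valP j; rewrite in_fset_set ?inE//; exact: finite_gen.
(* Given the tree up to height [n], the type vectors of total [l] have total probability one; they
   therefore also exhaust the smaller event of height [n.+1]. *)
have -> : (Pr (tree_event n.+1 t) =
    \sum_(c | J c) Pr (tree_event n.+1 t `&` S c))%E.
  apply: (measure_sum_full_pieces (measurable_tree_event n.+1 t)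
    (measurable_tree_event n t) mS tS).
    by move=> w; exact: trunc_eq_le.
  suff : (Pr (tree_event n t) = \sum_(c | J c) Pr (tree_event n t `&` S c))%E by [].
  under eq_bigr => c _ do rewrite /S given IH -!EFinM.
  by rewrite sumEFin -mulr_sumr (sum_type_law xi_pos tn) mulr1 IH.
under [LHS]eq_bigr => c _ do rewrite /S children_given_types given IH -!EFinM.
rewrite sumEFin; congr _%:E.
under [LHS]eq_bigr => c _ do rewrite -mulrA.
(* The weight at [(M_n, Z_n)] from the induction hypothesis cancels the denominator left by the sum
   over types. *)
rewrite -mulr_sumr (sum_type_child_law xi_pos p q tn) fsbig_gen_ltS /=.
have fn0 : fweight P l (M n t)%:R (Z n t) != 0.
  by rewrite gt_eqF// (fweight_gt0 xi_pos)//; exact: Z_gt0.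
by field.
Qed.

End weighted_tree.

(** * From cylinders to the whole sigma-field *)

Unset Implicit Arguments.

Theorem theorem1p2 (R : realType) (l : nat) (p q : nat -> R)
    (P Q : probability mtree R)
    (hl : (1 <= l)%N)
    (hp : is_offspring p)
    (hmean : (\sum_(0 <= k <oo) (k%:R * p k)%:E < 1)%E)
    (hp01 : p 0%N + p 1%N < 1)
    (hmom : (\sum_(0 <= k <oo) (k%:R ^+ l * p k)%:E < +oo)%E)
    (hq : forall k, 0 <= q k <= 1)
    (hpq : exists k, 0 < p k * q k)
    (hP : is_marked_GW p q P)
    (hQ : forall n (A : set mtree), filtration n A ->
       Q A = (\int[P]_(t in A) (fweight P l (M n t)%:R (Z n t))%:E)%E)
    (d : measure_display) (Omega : measurableType d)
    (Pr : probability Omega R) (tau : {RV Pr >-> mtree})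
    (typ : seq nat -> {RV Pr >-> nat}) :
  is_weighted_tree P p q tau typ l ->
  forall A : set mtree, measurable A -> distribution Pr tau A = Q A.
Proof.
move=> wt.
have Q_cylinder n t :
    (Q (cylinder n t) = (fweight P l (M n t)%:R (Z n t))%:E * P (cylinder n t))%E.
  rewrite (hQ _ _ (cylinder_filtration n t)).
  (* The density is constant on a cylinder of height [n], since [M_n] and [Z_n] depend only on the
     truncation. *)
  rewrite -integral_cst; last exact: filtration_measurable (cylinder_filtration n t).
  by apply: eq_integral => t'; rewrite inE => tt'; rewrite (M_trunc tt') (Z_trunc tt').
have cylinder0 t : cylinder 0 t = setT.
  by apply/seteqP; split=> // t' _; exact: trunc0_const.
have xil0 : xi P l != 0.
  apply/eqP => xi0; have := Q_cylinder 0%N trivial_tree.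
  rewrite fweightE xi0 invr0 mul0r mul0e cylinder0 probability_setT => /eqP.
  by rewrite onee_eq0.
have xi_pos i : (i <= l)%N -> 0 < xi P i := xi_gt0 xil0.
have P_cylinder n t : (P (cylinder n t) =
    (\big[*%R/1]_(u \in gen_lt t n) p0 p q (nchild t u) (mark t u))%:E)%E.
  (* The defining formula starts at height 1; at height 0 the cylinder is the whole space and the
     product is empty. *)
  case: n => [|n]; last exact: hP.
  by rewrite cylinder0 probability_setT gen_lt0 fsbig_set0.
have agree_cylinder n t : distribution Pr tau (cylinder n t) = Q (cylinder n t).
  by rewrite Q_cylinder P_cylinder -EFinM mulrC -(prob_tree_event wt).
have agree n (A : set mtree) : filtration n A -> distribution Pr tau A = Q A.
  move=> nA; rewrite -[RHS]mule1.
  (* An event of the filtration at height [n] is a countable disjoint union of cylinders: each fiber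
     of the code meets it in a cylinder or not at all. *)
  have fE c : A `&` trunc_code n @^-1` [set c] = set0 \/
      exists t, A `&` trunc_code n @^-1` [set c] = cylinder n t.
    have [[t [At tc]]|no] := pselect (exists t, A t /\ trunc_code n t = c); last first.
      by left; apply/seteqP; split=> // t [At tc]; apply: no; exists t.
    right; exists t; apply/seteqP; split=> t'.
      by move=> [_ /= t'c]; apply/trunc_code_inj; rewrite t'c.
    move=> /= t't; split; first exact: (filtration_inv nA (esym t't)).
    by rewrite /= -tc; apply/trunc_code_inj.
  have mf c : measurable (A `&` trunc_code n @^-1` [set c] : set mtree).
    have [->//|[t ->]] := fE c.
    exact: filtration_measurable (cylinder_filtration n t).
  apply: (@eq_measure_fibers _ _ mtree mtree R (distribution Pr tau) Q _
    (trunc_code n) (trunc_code n) A A 1 mf mf) => c.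
  rewrite mule1; have [->|[t ->]] := fE c; first by rewrite !measure0.
  exact: agree_cylinder.
move=> A mA.
(* The filtration is increasing, so its union is stable under intersection; it generates the
   sigma-field, and two finite measures that agree on it are equal. *)
apply: (@measure_unique _ R mtree (\bigcup_n filtration n) (fun=> setT)) => //.
- move=> B C [m _ mB] [n _ nC]; exists (maxn m n) => //.
  have := filtration_le (leq_maxl m n) mB; have := filtration_le (leq_maxr m n) nC.
  move=> nC' mB'; apply: filtrationP => t t' tt' [Bt Ct].
  by split; [exact: filtration_inv mB' tt' Bt|exact: filtration_inv nC' tt' Ct].
- by move=> _; exists 0%N => //; apply: filtrationP.
- by apply/seteqP; split=> // t _; exists 0%N.
- by move=> B [n _ /agree].
- by move=> _; apply: (@le_lt_trans _ _ 1%E); [exact: probability_le1|exact: ltry].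
Qed.
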